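(* Let $G$ be a connected $\mathbb{Z}$-gain graph. Then there exists a full placement-lattice $(p,L)$ of $G$ in $\mathbb{R}^2$ such that $(G,p,L)$ is a flexible full $1$-periodic framework if and only if either: (i) $G$ has a fixed lattice NBAC-colouring, (ii) $G$ has a flexible 1-lattice NBAC-colouring, or (iii) $G$ is balanced.
   Context: Gain graphs. A $\mathbb{Z}$-gain graph $G$ has a finite vertex set $V(G)$ and a (possibly infinite) edge set $E(G)$ of triples $(v,w,\gamma)\in V(G)^2\times\mathbb{Z}$, where $(v,w,\gamma)$ and $(w,v,-\gamma)$ are identified as the same edge, and no edge has the form $(v,v,0)$. Loops $(v,v,\gamma)$ with $\gamma\ne0$ and parallel edges are allowed. A circuit $C$ of length $n\ge1$ is a closed walk: a sequence $(e_1,\dots,e_n)$ of edges with orientations chosen so that $e_i=(v_i,v_{i+1},\gamma_i)$ and $v_{n+1}=v_1$; repetitions are allowed. Its gain is $\psi(C)=\gamma_1+\dots+\gamma_n$; $C$ is balanced if $\psi(C)=0$. A subgraph is balanced if all its circuits are balanced, and unbalanced otherwise. Colourings. For $\delta:E(G)\to\{\text{red},\text{blue}\}$, let $G^\delta_{\text{red}}$ (resp. $G^\delta_{\text{blue}}$) be the subgraph with vertex set $V(G)$ and all red (resp. blue) edges. An almost red circuit is a circuit with exactly one blue edge (counted with multiplicity, all other edges red); an almost blue circuit is a circuit with exactly one red edge. $\delta$ is an NBAC-colouring if it is surjective and there are no balanced almost red circuits and no balanced almost blue circuits. An NBAC-colouring is a fixed lattice NBAC-colouring if either $G^\delta_{\text{red}}$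 is balanced and $G$ has no almost blue circuits, or $G^\delta_{\text{blue}}$ is balanced and $G$ has no almost red circuits. An NBAC-colouring of a $\mathbb{Z}$-gain graph is a flexible 1-lattice NBAC-colouring if both $G^\delta_{\text{red}}$ and $G^\delta_{\text{blue}}$ are balanced. Frameworks. A placement-lattice of $G$ in $\mathbb{R}^2$ is a pair $(p,L)$ with $p:V(G)\to\mathbb{R}^2$ and $L\in M_{2\times 1}(\mathbb{R})$ such that $p(v)\ne p(w)+L\gamma$ for every $(v,w,\gamma)\in E(G)$; $(G,p,L)$ is then a $1$-periodic framework. It (and $(p,L)$) is full if $L$ is injective. $(G,p,L)$ and $(G,p',L')$ are equivalent if $\|p(v)-p(w)-L\gamma\|^2=\|p'(v)-p'(w)-L'\gamma\|^2$ for all $(v,w,\gamma)\in E(G)$; $(p,L)$ and $(p',L')$ are congruent if this equality holds for all $v,w\in V(G)$ and $\gamma\in\mathbb{Z}$. A flex of $(G,p,L)$ is a continuous path $t\mapsto(p_t,L_t)$, $t\in[0,1]$, of placement-lattices of $G$ with $(p_0,L_0)=(p,L)$ and $(G,p_t,L_t)$ equivalent to $(G,p,L)$ for all $t$; it is trivial if $(p_t,L_t)$ is congruent to $(p,L)$ for all $t$. $(G,p,L)$ is flexible if it has a non-trivial flex. *)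

(* Defs.v *)
From HB Require Import structures.
From mathcomp Require Import all_boot all_order all_algebra.
From mathcomp Require Import all_classical all_reals all_analysis.

Set Implicit Arguments.
Unset Strict Implicit.
Unset Printing Implicit Defensive.

Import Order.TTheory GRing.Theory Num.Theory.
Import numFieldNormedType.Exports.

Local Open Scope classical_set_scope.
Local Open Scope ring_scope.

(* A triple (v, w, g) is an edge together with an orientation; the two          *)
(* orientations (v, w, g) and (w, v, -g) of an edge are swapped by [erev].      *)
Definition oedge (V : finType) : Type := (V * V * int)%type.
Definition esrc (V : finType) (e : oedge V) : V := e.1.1.
Definition etgt (V : finType) (e : oedge V) : V := e.1.2.
Definition egain (V : finType) (e : oedge V) : int := e.2.
Definition erev (V : finType) (e : oedge V) : oedge V :=
  (etgt e, esrc e, - egain e).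

(* The identification of (v, w, g) with (w, v, -g) is rendered by an edge set   *)
(* closed under [erev].                                                         *)
Record gain_graph (V : finType) := GainGraph {
  edges : set (oedge V);
  edges_rev : forall e, edges e -> edges (erev e);
  edges_loop : forall v, ~ edges (v, v, 0) }.

Section Walks.
Variables (V : finType) (G : gain_graph V).

Fixpoint walk (v : V) (c : seq (oedge V)) (w : V) : Prop :=
  if c is e :: c' then [/\ edges G e, esrc e = v & walk (etgt e) c' w]
  else v = w.

Definition circuit (c : seq (oedge V)) : Prop :=
  c <> [::] /\ exists v, walk v c v.

Definition walk_gain (c : seq (oedge V)) : int := \sum_(e <- c) egain e.

Definition balanced : Prop := forall c, circuit c -> walk_gain c = 0.

Definition graph_connected : Prop :=
  inhabited V /\ forall v w, exists c, walk v c w.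

End Walks.

Variant colour := Red | Blue.

Definition is_red (k : colour) : bool := if k is Red then true else false.
Definition is_blue (k : colour) : bool := if k is Blue then true else false.

(* Only the values of [col] on the edges of [G] matter; compatibility with      *)
(* [erev] makes it a function on unoriented edges.                              *)
Record colouring (V : finType) (G : gain_graph V) := Colouring {
  col : oedge V -> colour;
  col_rev : forall e, edges G e -> col (erev e) = col e }.

Section Colourings.
Variables (V : finType) (G : gain_graph V) (d : colouring G).

Definition colour_edges (k : colour) : set (oedge V) :=
  [set e | edges G e /\ col d e = k].

Lemma colour_edges_rev k e : colour_edges k e -> colour_edges k (erev e).
Proof. by case=> Ge <-; split; [exact: edges_rev | exact: col_rev]. Qed.

Lemma colour_edges_loop k v : ~ colour_edges k (v, v, 0).
Proof. by case=> /edges_loop. Qed.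

Definition colour_subgraph (k : colour) : gain_graph V :=
  GainGraph (@colour_edges_rev k) (@colour_edges_loop k).

Definition almost_red_circuit (c : seq (oedge V)) : Prop :=
  circuit G c /\ count (fun e => is_blue (col d e)) c = 1%N.

Definition almost_blue_circuit (c : seq (oedge V)) : Prop :=
  circuit G c /\ count (fun e => is_red (col d e)) c = 1%N.

Definition NBAC : Prop :=
  [/\ forall k, exists2 e, edges G e & col d e = k,
      ~ (exists c, almost_red_circuit c /\ walk_gain c = 0) &
      ~ (exists c, almost_blue_circuit c /\ walk_gain c = 0)].

Definition fixed_lattice_NBAC : Prop :=
  NBAC /\
  ((balanced (colour_subgraph Red) /\ ~ (exists c, almost_blue_circuit c)) \/
   (balanced (colour_subgraph Blue) /\ ~ (exists c, almost_red_circuit c))).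

Definition flexible_1_lattice_NBAC : Prop :=
  [/\ NBAC, balanced (colour_subgraph Red) & balanced (colour_subgraph Blue)].

End Colourings.

Section Frameworks.
Variables (R : realType) (V : finType).

(* The library norm on matrices is the sup norm, hence this definition of the   *)
(* squared Euclidean norm.                                                      *)
Definition sqnorm (u : 'cV[R]_2) : R := \sum_i u i 0 ^+ 2.

Definition lat (L : 'M[R]_(2, 1)) (g : int) : 'cV[R]_2 := L *m (g%:~R)%:M.

Definition placement : Type := ((V -> 'cV[R]_2) * 'M[R]_(2, 1))%type.

Implicit Types (G : gain_graph V) (x y : placement).

Definition placement_lattice G x : Prop :=
  forall v w g, edges G (v, w, g) -> x.1 v <> x.1 w + lat x.2 g.

Definition full x : Prop := injective (fun u : 'cV[R]_1 => x.2 *m u).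

Definition sqlen x (v w : V) (g : int) : R :=
  sqnorm (x.1 v - x.1 w - lat x.2 g).

Definition equivalent G x y : Prop :=
  forall v w g, edges G (v, w, g) -> sqlen x v w g = sqlen y v w g.

Definition congruent x y : Prop :=
  forall v w g, sqlen x v w g = sqlen y v w g.

(* Only the values of the path [z] on [0, 1] matter.                            *)
Definition flex G x (z : R -> placement) : Prop :=
  [/\ forall v, {within `[0, 1], continuous (fun t => (z t).1 v)},
      {within `[0, 1], continuous (fun t => (z t).2)},
      z 0 = x,
      forall t, 0 <= t <= 1 -> placement_lattice G (z t) &
      forall t, 0 <= t <= 1 -> equivalent G (z t) x].

Definition trivial_flex x (z : R -> placement) : Prop :=
  forall t, 0 <= t <= 1 -> congruent (z t) x.

Definition flexible G x : Prop :=
  exists z, flex G x z /\ ~ trivial_flex x z.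

End Frameworks.

(* Main.v *)
From Pilot Require Import Defs.
From HB Require Import structures.
From mathcomp Require Import all_boot all_order all_algebra.
From mathcomp Require Import all_classical all_reals all_analysis.
From mathcomp Require Import complex zify ring lra.

(* From a flex to a colouring: let A be the subring of C generated by the       *)
(* inverses of the nonzero integers and by all squared lengths of the initial   *)
(* placement together with their inverses. It is countable, whereas some        *)
(* squared length c takes uncountably many values along the flex, so at some    *)
(* time t it is not integral over A, and C has a valuation ring O containing A  *)
(* but not c. Writing an edge vector (x, y) at time t as W = x + i y and        *)
(* Z = x - i y, the product W Z is a unit of O, so comparing the valuations of  *)
(* the W's with that of a fixed edge e0 (blue iff W / W0 is in O, equivalently  *)
(* red iff Z W0 is in the maximal ideal) colours the edges. Summing W / W0 or   *)
(* Z W0 around a circuit excludes the balanced almost monochromatic circuits;   *)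
(* if a colour has an unbalanced circuit, the same sum puts the corresponding   *)
(* coordinate of L in O (resp. in the maximal ideal) and then excludes all      *)
(* circuits almost of that colour. Both colours cannot be unbalanced, as        *)
(* |L|^2 would be in the maximal ideal: c is chosen to be |L|^2 unless |L|^2    *)
(* is constant along the flex, in which case it is a unit of A.                 *)
(* From a colouring to a flex: put p_t(v) = A(v) u + B(v) u_t and               *)
(* L_t = a u + b u_t with u, u_t unit vectors at a varying angle; lengths of    *)
(* edges parallel to u or to u_t are preserved.                                 *)

Set Implicit Arguments.
Unset Strict Implicit.
Unset Printing Implicit Defensive.

Import Order.TTheory GRing.Theory Num.Theory.
Import numFieldNormedType.Exports.
Import Pilot.Defs.

Local Open Scope classical_set_scope.
Local Open Scope ring_scope.

(** Both directions split edge vectors into two coordinates that add up along walks. Over the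
    complex numbers a squared length factors as W Z; where it is a unit of a valuation ring, W and Z
    have opposite valuations, and [valuation_colouring] colours edges by the valuation of W.
    [countable_nonintegral] and [itv_not_countable] supply a time of the flex at which some squared
    length is not integral, and [valuation_ring_exists] turns this into a ring that separates two
    edges.

    Conversely, [flexible_of_directions] needs two real coordinates, exactly one of which vanishes
    on each edge. A balanced colour class has an integer potential ([balanced_potential]), hence a
    coordinate vanishing on it. Shifting its components by distinct fractions ([frac_eq]) makes that
    coordinate nonzero on the other class, where a zero would close up a balanced almost
    monochromatic circuit. *)

(** * Subrings, countable generation and adjunction of an element *)

Definition subring (S : pzRingType) (B : set S) : Prop :=
  [/\ B 1, forall x y, B x -> B y -> B (x - y)
    & forall x y, B x -> B y -> B (x * y)].

Section SubringTheory.
Variables (S : pzRingType) (B : set S).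
Hypothesis hB : subring B.

Lemma subring1 : B 1. Proof. by case: hB. Qed.
Lemma subringB x y : B x -> B y -> B (x - y). Proof. by case: hB => _ h _; apply: h. Qed.
Lemma subringM x y : B x -> B y -> B (x * y). Proof. by case: hB => _ _; apply. Qed.
Lemma subring0 : B 0. Proof. by rewrite -(subrr 1); apply: subringB subring1 subring1. Qed.
Lemma subringN x : B x -> B (- x). Proof. by rewrite -sub0r; apply: subringB subring0. Qed.
Lemma subringD x y : B x -> B y -> B (x + y).
Proof. by move=> Bx /subringN By; rewrite -[y]opprK; apply: subringB. Qed.
Lemma subringX x n : B x -> B (x ^+ n).
Proof.
by move=> Bx; elim: n => [|n IH]; rewrite ?expr0 ?exprS; [exact: subring1|exact: subringM].
Qed.
Lemma subring_sum (I : Type) (r : seq I) (P : pred I) (f : I -> S) :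
  (forall i, P i -> B (f i)) -> B (\sum_(i <- r | P i) f i).
Proof. by move=> h; apply: (big_ind B subring0 subringD h). Qed.
Lemma subring_int (n : int) : B n%:~R.
Proof.
have Bn m : B m%:R.
  by elim: m => [|m IH]; [exact: subring0 | rewrite mulrS; exact: subringD subring1 IH].
by case: n => n; rewrite ?NegzE ?mulrNz; [exact: Bn | apply/subringN/(Bn n.+1)].
Qed.
End SubringTheory.

Lemma countable_subring (S : pzRingType) (I : countType) (g : I -> S) :
  exists B : set S, [/\ countable B, subring B & forall i, B (g i)].
Proof.
(* Ring expressions coded as trees, a countable type: two children stand for a difference, three or
   more for the product of the first two, anything else for 1. *)
pose fix ev (t : GenTree.tree I) : S := match t with
  | GenTree.Leaf i => g i
  | GenTree.Node _ [:: t1; t2] => ev t1 - ev t2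
  | GenTree.Node _ [:: t1, t2 & _] => ev t1 * ev t2
  | GenTree.Node _ _ => 1
  end.
exists (range ev); split.
- exact: sub_countable (card_image_le _ _) (countableP _).
- split.
  + by exists (GenTree.Node 0 [::]).
  + by move=> _ _ [t1 _ <-] [t2 _ <-]; exists (GenTree.Node 0 [:: t1; t2]).
  + by move=> _ _ [t1 _ <-] [t2 _ <-]; exists (GenTree.Node 0 [:: t1; t2; t1]).
- by move=> i; exists (GenTree.Leaf i).
Qed.

Definition adjoin (F : fieldType) (B : set F) (x : F) : set F :=
  [set p.[x] | p in [set p : {poly F} | forall i, B p`_i]].

Section Adjoin.
Variables (F : fieldType) (B : set F) (x : F).
Hypothesis hB : subring B.

Lemma adjoin_subring : subring (adjoin B x).
Proof.
split.
- exists 1; last by rewrite hornerC.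
  by move=> i /=; rewrite coef1; apply: subring_int hB (i == 0%N).
- move=> _ _ [p Bp <-] [q Bq <-]; exists (p - q); last by rewrite hornerD hornerN.
  by move=> i /=; rewrite coefB; apply: subringB.
- move=> _ _ [p Bp <-] [q Bq <-]; exists (p * q); last by rewrite hornerM.
  by move=> i /=; rewrite coefM; apply: subring_sum => // j _; apply: subringM.
Qed.

Lemma sub_adjoin : B `<=` adjoin B x.
Proof.
move=> b Bb; exists b%:P; last by rewrite hornerC.
by move=> i /=; rewrite coefC; case: eqP => // _; apply: subring0.
Qed.

Lemma mem_adjoin : adjoin B x x.
Proof.
exists 'X; last by rewrite hornerX.
by move=> i /=; rewrite coefX; apply: subring_int hB (i == 1%N).
Qed.
End Adjoin.

(** * Existence of valuation rings *)

Lemma maximal_subring (F : fieldType) (B0 : set F) (c : F) :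
    subring B0 -> ~ B0 c ->
  exists B : set F, [/\ subring B, B0 `<=` B, ~ B c &
    forall B', subring B' -> B `<=` B' -> ~ B' c -> B' `<=` B].
Proof.
move=> hB0 cB0.
(* Joining [B0] to [X] makes the property hold for the empty set, the union of the empty chain. *)
pose P (X : set F) := subring (X `|` B0) /\ ~ (X `|` B0) c.
have [X [[hX cX] Xmax]] : exists A, P A /\ forall B, A `<` B -> ~ P B.
  apply: Zorn_bigcup => C CP Ctot.
  have pick2 x y : (\bigcup_(X in C) X `|` B0) x -> (\bigcup_(X in C) X `|` B0) y ->
      exists D : set F, [/\ subring D, D `<=` \bigcup_(X in C) X `|` B0, D x & D y].
    have good X : C X -> subring (X `|` B0) /\ X `|` B0 `<=` \bigcup_(X in C) X `|` B0.
      move=> CX; split; first by case: (CP _ CX).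
      by move=> z [Xz|]; [left; exists X | right].
    case=> [[X CX Xx]|Bx] [[Y CY Yy]|By].
    - have [XY|YX] := Ctot _ _ CX CY.
        by exists (Y `|` B0); have [? ?] := good _ CY; split=> //; left=> //; apply: XY.
      by exists (X `|` B0); have [? ?] := good _ CX; split=> //; left=> //; apply: YX.
    - by exists (X `|` B0); have [? ?] := good _ CX; split; [by []|by []|by left|by right].
    - by exists (Y `|` B0); have [? ?] := good _ CY; split; [by []|by []|by right|by left].
    - by exists B0; split=> // z; right.
  split; last by case=> [[X CX Xc]|//]; case: (CP _ CX) => _; apply; left.
  split; first by right; apply: subring1.
  - by move=> x y hx hy; have [D [hD sD Dx Dy]] := pick2 _ _ hx hy; apply: sD; apply: subringB.
  - by move=> x y hx hy; have [D [hD sD Dx Dy]] := pick2 _ _ hx hy; apply: sD; apply: subringM.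
exists (X `|` B0); split=> //.
move=> B' hB' sB cB' z B'z.
have eB : B' `|` B0 = B' by apply/setUidPl => u ?; apply: sB; right.
apply: contrapT => nXz; apply: (Xmax B'); last by split; rewrite eB.
split; first by move=> u ?; apply: sB; left.
by move=> B'X; apply: nXz; left; apply: B'X.
Qed.

(* Chevalley's extension theorem, in the form: a subring containing [c^-1] but *)
(* not [c] lies in a valuation ring whose maximal ideal contains [c^-1].        *)
Lemma valuation_ring_exists (F : fieldType) (B0 : set F) (c : F) :
    subring B0 -> B0 c^-1 -> ~ B0 c ->
  exists O : set F, [/\ subring O, B0 `<=` O, ~ O c & forall x, O x \/ O x^-1].
Proof.
move=> hB0 yB0 cB0; have [B [hB sB cB Bmax]] := maximal_subring hB0 cB0.
have {}Bmax x : ~ B x -> adjoin B x c.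
  move=> Bx; apply: contrapT => nc; apply: Bx.
  by apply: (Bmax _ (adjoin_subring x hB) (sub_adjoin x hB) nc); apply: mem_adjoin.
have By : B c^-1 by apply: sB.
exists B; split=> // {B0 hB0 cB0 sB yB0}.
have c0 : c != 0 by apply: contra_notN cB => /eqP ->; apply: subring0.
(* With s = 1 - b/c, c s = c - b, so c s^n is congruent to c modulo [B] for all n. If s^-1 were not
   in [B], maximality would make c a polynomial in s^-1; clearing denominators puts some c s^n,
   hence c, in [B]. *)
have B_inv b : B b -> B (1 - c^-1 * b)^-1.
  move=> Bb; apply: contrapT => /Bmax [p Bp pc].
  set s := 1 - c^-1 * b in pc.
  have s0 : s != 0.
    rewrite subr_eq0; apply: contra_notN cB => /eqP /(congr1 (fun z => c * z)).
    by rewrite mulr1 mulrA divff // mul1r => ->.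
  have Bs : B s by apply: subringB => //; [exact: subring1 | exact: subringM].
  have Bcs n : B (c * s ^+ n - c).
    elim: n => [|n IH]; first by rewrite expr0 mulr1 subrr; apply: subring0.
    have -> : c * s ^+ n.+1 - c = (c * s ^+ n - c) * s - b.
      rewrite exprSr mulrA mulrBl -addrA; congr (_ + _).
      by rewrite mulrBr mulr1 mulrA divff // mul1r opprB addrC addrA addNr sub0r.
    by apply: subringB => //; apply: subringM.
  have Bcs' : B (c * s ^+ (size p)).
    rewrite -pc horner_coef mulr_suml; apply: subring_sum => // i _.
    rewrite -mulrA exprVn; apply: subringM => //.
    by rewrite mulrC -expfB //; apply: subringX.
  by apply: cB; rewrite -[c](subKr (c * s ^+ size p)); apply: subringB.
(* A relation of degree at most n for x with coefficients in c^-1 [B]. If x and x^-1 both lay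
   outside [B], both would have one, and [D_red] would lower the larger degree forever. *)
pose D n x := exists b : nat -> F,
  (forall i, B (b i)) /\ 1 = \sum_(i < n.+1) c^-1 * b i * x ^+ i.
have D_ex x : ~ B x -> exists n, D n x.
  move=> /Bmax [p Bp pc]; exists (size p), (nth 0 p); split=> //.
  rewrite big_ord_recr /= nth_default // mulr0 mul0r addr0.
  transitivity (c^-1 * p.[x]); first by rewrite pc mulVf.
  by rewrite horner_coef mulr_sumr; apply: eq_bigr => i _; rewrite mulrA.
have D_mono m n x : (m <= n)%N -> D m x -> D n x.
  move=> mn [b [Bb e]]; exists (fun i => if (i <= m)%N then b i else 0); split.
    by move=> i; case: ifP => // _; apply: subring0.
  rewrite e (big_ord_widen n.+1 (fun i => c^-1 * b i * x ^+ i)) // big_mkcond /=.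
  apply: eq_bigr => i _; rewrite ltnS; case: ifP => // _.
  by rewrite mulr0 mul0r.
(* The relation for x^-1 has constant coefficient c^-1 q_0, and 1 - c^-1 q_0 is a unit of [B]. It
   thus expresses 1 by negative powers of x, which rewrites the leading term of the relation for x
   in lower degrees. Degree 0 would give c in [B]. *)
have D_red n x : x != 0 -> D n x -> D n x^-1 -> exists2 m, (m < n)%N & D m x.
  move=> x0 [b [Bb e]] [q [Bq f]]; case: n e f => [|n] e f.
    exfalso; apply: cB; move: e; rewrite big_ord_recl big_ord0 expr0 mulr1 addr0.
    by move=> /(congr1 (fun z => c * z)); rewrite mulr1 mulrA divff // mul1r => ->.
  pose u := (1 - c^-1 * q 0)^-1.
  have Bu : B u by apply: B_inv.
  have s0 : 1 - c^-1 * q 0 != 0.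
    rewrite subr_eq0; apply: contra_notN cB => /eqP /(congr1 (fun z => c * z)).
    by rewrite mulr1 mulrA divff // mul1r => ->.
  have {f}f : 1 = \sum_(j < n.+1) u * c^-1 * q j.+1 * x ^- j.+1.
    rewrite -(mulVf s0) -/u [X in u * (X - _)]f big_ord_recl expr0 mulr1 addrC addKr.
    by rewrite mulr_sumr; apply: eq_bigr => j _; rewrite -exprVn !mulrA.
  exists n => //.
  exists (fun i => b i + c^-1 * b n.+1 * u * q (n - i).+1); split.
    by move=> i; apply: subringD => //; do !apply: subringM => //.
  rewrite e big_ord_recr /=.
  under [RHS]eq_bigr do rewrite mulrDr mulrDl.
  rewrite big_split /=; congr (_ + _).
  rewrite -[LHS]mulr1 f mulr_sumr (reindex_inj rev_ord_inj) /=.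
  apply: eq_bigr => i _; rewrite subSS.
  have -> : x ^+ n.+1 = x ^+ i * x ^+ (n - i).+1.
    by rewrite -exprD addnS subnKC // -ltnS.
  have : x ^+ (n - i).+1 != 0 by rewrite expf_neq0.
  move: (x ^+ (n - i).+1) (x ^+ i) => z t z0; clearbody u; field; by rewrite z0 c0.
move=> x; apply: contrapT => /not_orP [Bx Bx'].
have x0 : x != 0 by apply: contra_notN Bx => /eqP ->; apply: subring0.
have [n Dn] := D_ex _ Bx; have [m Dm] := D_ex _ Bx'.
have [k le_k] := ubnP (n + m); elim: k => // k IH in n m x x0 Dn Dm le_k {Bx Bx'} *.
have [mn|/ltnW nm] := leqP m n.
  have [n' n'n Dn'] := D_red _ _ x0 Dn (D_mono _ _ _ mn Dm).
  by apply: (IH n' m x) => //; rewrite -ltnS (leq_trans _ le_k) // ltnS ltn_add2r.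
have x'0 : x^-1 != 0 by rewrite invr_eq0.
have [m' m'm Dm'] : exists2 m', (m' < m)%N & D m' x^-1.
  by apply: D_red => //; rewrite invrK; apply: D_mono Dn.
by apply: (IH n m' x) => //; rewrite -ltnS (leq_trans _ le_k) // ltnS ltn_add2l.
Qed.

(** * Walks, components and potentials *)

Section WalkTheory.
Variables (V : finType) (G : gain_graph V).

Lemma walk_cat u v w c1 c2 :
  walk G u c1 v -> walk G v c2 w -> walk G u (c1 ++ c2) w.
Proof. by elim: c1 u => [|e c1 IH] u /= => [->//|[Ge eu /IH h]] /h. Qed.

Lemma walk_rev v w c : walk G v c w -> walk G w (rev (map (@erev V) c)) v.
Proof.
elim: c v => [|e c IH] v /=; first by move=> ->.
case=> Ge <- /IH h; rewrite rev_cons -cats1; apply: walk_cat h _.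
by split=> //; exact: edges_rev.
Qed.

Lemma walk_gain_cat (c1 c2 : seq (oedge V)) :
  walk_gain (c1 ++ c2) = walk_gain c1 + walk_gain c2.
Proof. exact: big_cat. Qed.

Lemma walk_gain_cons (e : oedge V) c : walk_gain (e :: c) = egain e + walk_gain c.
Proof. exact: big_cons. Qed.

Lemma walk_gain_rev (c : seq (oedge V)) :
  walk_gain (rev (map (@erev V) c)) = - walk_gain c.
Proof.
rewrite /walk_gain (perm_big (map (@erev V) c)) ?perm_rev //=.
by rewrite big_map -sumrN.
Qed.

Lemma walk_edges v w c : walk G v c w -> forall e, e \in c -> edges G e.
Proof.
elim: c v => // e c IH v /= [Ge _ /IH h] f; rewrite inE => /orP[/eqP->|] //.
exact: h.
Qed.

Lemma walk_gain_unique v w c1 c2 : balanced G ->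
  walk G v c1 w -> walk G v c2 w -> walk_gain c1 = walk_gain c2.
Proof.
move=> balG w1 /walk_rev w2; apply/eqP; rewrite -subr_eq0 -walk_gain_rev -walk_gain_cat.
case E: (c1 ++ _) => [|e c]; first by rewrite /walk_gain big_nil.
rewrite -E balG //; split; first by rewrite E.
by exists v; apply: walk_cat w1 w2.
Qed.

Lemma component_representative : exists r : V -> V,
  [/\ forall v w c, walk G v c w -> r v = r w,
      forall v w, r v = r w -> exists c, walk G v c w &
      forall v, r (r v) = r v].
Proof.
pose conn v w := `[< exists c, walk G v c w >].
(* [pick] depends only on the extension of its predicate, so connected vertices get the same
   representative. *)
pose r v := odflt v [pick u | conn v u].
have r_conn v : conn v (r v).
  by rewrite /r; case: pickP => //= /(_ v) /asboolP[]; exists [::].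
have r_walk v w c : walk G v c w -> r v = r w.
  move=> vw; rewrite /r (@eq_pick _ (conn v) (conn w)).
    by case: pickP => //= /(_ w) /asboolP[]; exists [::].
  move=> u; apply/asboolP/asboolP => -[c' h].
    by exists (rev (map (@erev V) c) ++ c'); apply: walk_cat h; apply: walk_rev.
  by exists (c ++ c'); apply: walk_cat h.
exists r; split=> [//|v w rvw|v]; last first.
  by have /asboolP[c /r_walk] := r_conn v.
have /asboolP[c1 h1] := r_conn v; have /asboolP[c2 h2] := r_conn w.
exists (c1 ++ rev (map (@erev V) c2)); apply: walk_cat h1 _.
by rewrite rvw; apply: walk_rev.
Qed.

(** The potential of a vertex is the gain of any walk to it from the representative of its
    component; balance makes this independent of the walk. *)
Lemma balanced_potential : balanced G -> exists (r : V -> V) (h : V -> int),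
  (forall v w g, edges G (v, w, g) -> r v = r w /\ g = h w - h v) /\
  (forall v w, r v = r w -> exists2 c, walk G v c w & walk_gain c = h w - h v).
Proof.
move=> balG; have [r [r_walk r_conn r_idem]] := component_representative.
have rr v : exists c, walk G (r v) c v.
  exact: r_conn.
have [c cP] := choice rr.
have gainE v w c' : walk G v c' w -> walk_gain c' = walk_gain (c w) - walk_gain (c v).
  move=> vw; apply/eqP; rewrite eq_sym subr_eq addrC -walk_gain_cat; apply/eqP.
  apply: (walk_gain_unique balG (cP w)).
  by rewrite -(r_walk _ _ _ vw); apply: walk_cat (cP v) vw.
exists r, (fun v => walk_gain (c v)); split=> [v w g e|v w /r_conn[c' vw]].
  have vw : walk G v [:: (v, w, g)] w by split.
  split; first exact: r_walk vw.
  by rewrite -(gainE _ _ _ vw) walk_gain_cons /walk_gain big_nil addr0.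
by exists c' => //; apply: gainE.
Qed.

End WalkTheory.

(** * Circuits almost of one colour *)

Definition opp_col (k : colour) : colour := if k is Red then Blue else Red.
Definition is_col (k : colour) : colour -> bool := if k is Red then is_red else is_blue.

Lemma is_colP k k' : reflect (k' = k) (is_col k k').
Proof. by case: k; case: k'; constructor. Qed.

Lemma is_col_opp k k' : is_col (opp_col k) k' = ~~ is_col k k'.
Proof. by case: k; case: k'. Qed.

Section ColouredCircuits.
Variables (V : finType) (G : gain_graph V) (d : colouring G).

(* [almost Red] and [almost Blue] are [almost_red_circuit] and *)
(* [almost_blue_circuit] up to conversion. *)
Definition almost (k : colour) (c : seq (oedge V)) : Prop :=
  circuit G c /\ count (fun e => is_col (opp_col k) (col d e)) c = 1%N.

Lemma colour_walk k v w c : walk (colour_subgraph d k) v c w ->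
  walk G v c w /\ all (fun e => is_col k (col d e)) c.
Proof.
elim: c v => //= e c IH v [[Ge ek] <- /IH[h1 h2]].
by split=> //; apply/andP; split=> //; apply/is_colP.
Qed.

Lemma almost_cons k v w g c : edges G (v, w, g) -> col d (v, w, g) = opp_col k ->
  walk (colour_subgraph d k) w c v -> almost k ((v, w, g) :: c).
Proof.
move=> Ge ek /colour_walk[wc ck]; split.
  by split=> //; exists v; split.
rewrite /= ek; have -> : is_col (opp_col k) (opp_col k) by apply/is_colP.
congr _.+1; apply/eqP; rewrite -leqn0 leqNgt -has_count -all_predC.
by apply: sub_all ck => e; rewrite /= is_col_opp negbK.
Qed.

End ColouredCircuits.

(** * From a colouring to a flex *)

Section Construction.
Variables (R : realType) (V : finType) (G : gain_graph V).

(** The vector a u + b u_t, where u is the first basis vector and u_t turns from u at t = 0 to the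
    perpendicular direction at t = 1. *)
Definition oblique (a b t : R) : 'M[R]_(2, 1) :=
  (a + b * cos (t * (pi / 2))) *: delta_mx 0 0 + (b * sin (t * (pi / 2))) *: delta_mx 1 0.

Lemma obliqueE a b t :
  (oblique a b t 0 0 = a + b * cos (t * (pi / 2))) *
  (oblique a b t 1 0 = b * sin (t * (pi / 2))).
Proof. by split; rewrite !mxE /= ?mulr1 ?mulr0 ?addr0 ?add0r. Qed.

Lemma continuous_oblique a b : continuous (oblique a b).
Proof.
have ct : continuous (fun t : R => t * (pi / 2)).
  by move=> t; apply: cvgM; [exact: cvg_id | exact: cvg_cst].
move=> t; apply: cvgD; apply: cvgZ; try exact: cvg_cst.
- apply: cvgD; first exact: cvg_cst.
  apply: cvgM; first exact: cvg_cst.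
  by apply: (continuous_comp (ct t)); exact: continuous_cos.
- apply: cvgM; first exact: cvg_cst.
  by apply: (continuous_comp (ct t)); exact: continuous_sin.
Qed.

Lemma lat_entry (L : 'M[R]_(2, 1)) g i : lat L g i 0 = L i 0 * g%:~R.
Proof. by rewrite /lat mxE big_ord1 [(_%:M) _ _]mxE eqxx mulr1n. Qed.

Lemma sqlenE (x : placement R V) v w g : sqlen x v w g =
  (x.1 v 0 0 - x.1 w 0 0 - x.2 0 0 * g%:~R) ^+ 2 +
  (x.1 v 1 0 - x.1 w 1 0 - x.2 1 0 * g%:~R) ^+ 2.
Proof.
rewrite /sqlen /sqnorm big_ord_recl big_ord1 -!lat_entry !mxE.
by have -> : lift 0 0 = 1 :> 'I_2 by apply: val_inj.
Qed.

Variables (A B : V -> R) (a b : R).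
Let X v w (g : int) : R := A v - A w - a * g%:~R.
Let Y v w (g : int) : R := B v - B w - b * g%:~R.
Let z t : placement R V := (fun v => oblique (A v) (B v) t, oblique a b t).

Let sqlen_z t v w g : sqlen (z t) v w g =
  X v w g ^+ 2 + Y v w g ^+ 2 + 2 * X v w g * Y v w g * cos (t * (pi / 2)).
Proof.
rewrite sqlenE /= !obliqueE /X /Y.
have := cos2Dsin2 (t * (pi / 2)).
move: (cos _) (sin _) => c s /(canRL (addKr _)) e.
transitivity ((A v - A w - a * g%:~R + (B v - B w - b * g%:~R) * c) ^+ 2 +
   (B v - B w - b * g%:~R) ^+ 2 * s ^+ 2); first by ring.
by rewrite e; ring.
Qed.

(** The squared length of X u + Y u_t depends on t only through 2 X Y cos(t pi/2). It is constant
    and nonzero on edges, while a triple with X and Y both nonzero changes length. At t = 0 the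
    lattice vector is (a + b) u, whence fullness. *)
Lemma flexible_of_directions : a + b != 0 ->
  (forall v w g, edges G (v, w, g) -> (X v w g == 0) (+) (Y v w g == 0)) ->
  (exists v w g, X v w g != 0 /\ Y v w g != 0) ->
  exists x : placement R V, [/\ placement_lattice G x, full x & flexible G x].
Proof.
move=> ab0 XY [v0 [w0 [g0 [X0 Y0]]]].
have placed t : placement_lattice G (z t).
  move=> v w g e eq_p.
  have : sqlen (z t) v w g = 0.
    rewrite /sqlen eq_p -addrA -opprD subrr /sqnorm big1 // => i _.
    by rewrite mxE expr0n.
  rewrite sqlen_z; move: (XY _ _ _ e).
  have [->|Xn0] := eqVneq (X v w g) 0; have [->|Yn0] := eqVneq (Y v w g) 0 => //= _ /eqP.
    by rewrite mulr0 mul0r mul0r addr0 expr0n add0r sqrf_eq0 (negPf Yn0).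
  by rewrite mulr0 mul0r addr0 expr0n addr0 sqrf_eq0 (negPf Xn0).
exists (z 0); split => //.
- move=> u1 u2 /= /matrixP /(_ 0 0); rewrite !mxE !big_ord1 obliqueE.
  rewrite mul0r cos0 mulr1 => /(mulfI ab0) e.
  by apply/matrixP => i j; rewrite !ord1.
exists z; split.
  split=> //.
  - by move=> v; apply: continuous_subspaceT; exact: continuous_oblique.
  - by apply: continuous_subspaceT; exact: continuous_oblique.
  - move=> t _ v w g e; rewrite !sqlen_z; move: (XY _ _ _ e).
    case: eqP => [->|_]; case: eqP => [->|_] //= _; by rewrite !(mulr0, mul0r).
move=> /(_ 1); rewrite ler01 lexx => /(_ isT v0 w0 g0).
rewrite !sqlen_z mul1r mul0r cos0 cos_pihalf mulr0 mulr1 addr0 => /esym/eqP.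
rewrite -subr_eq0 addrC addKr !mulf_eq0 (negPf X0) (negPf Y0) orbF orbF.
by rewrite pnatr_eq0.
Qed.

End Construction.

Section Fraction.
Variables (R : realType) (V : finType).

(** Distinct numbers in [0, 1), no two of which differ by an integer, so that integer potentials
    cannot cancel their differences. *)
Definition frac (v : V) : R := (enum_rank v)%:R / #|V|%:R.

Lemma frac_eq (v w : V) (m : int) : frac v - frac w = m%:~R -> v = w /\ m = 0.
Proof.
have V0 : (0 < #|V|)%N by apply/card_gt0P; exists v.
have V0' : #|V|%:R != 0 :> R by rewrite pnatr_eq0 -lt0n.
rewrite /frac -mulrBl => /(canRL (mulfVK V0')) eR.
have {eR}e : (enum_rank v)%:Z - (enum_rank w)%:Z = m * #|V|%:Z.
  by apply: (@intr_inj R); rewrite rmorphB rmorphM /= -!pmulrn.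
have lt_v := ltn_ord (enum_rank v); have lt_w := ltn_ord (enum_rank w).
have m0 : m = 0.
  have arith (i j N : nat) : (i < N)%N -> (j < N)%N -> i%:Z - j%:Z = m * N%:Z -> m = 0.
    by have [m0|m0|//] := ltgtP m 0; nia.
  exact: arith lt_v lt_w e.
split=> //; apply: enum_rank_inj; apply: val_inj => /=.
by move: e; rewrite m0 mul0r => /eqP; rewrite subr_eq0 => /eqP[].
Qed.
End Fraction.

Section Converse.
Variables (R : realType) (V : finType) (G : gain_graph V).
Hypothesis hG : graph_connected G.

(** A potential of the whole graph makes the first coordinate vanish on every edge; the second could
    vanish only on a loop of gain 0. *)
Lemma balanced_flexible : balanced G ->
  exists x : placement R V, [/\ placement_lattice G x, full x & flexible G x].
Proof.
move=> /balanced_potential[r [h [hE _]]]; have [[v0] _] := hG.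
apply: (@flexible_of_directions _ _ _ (fun v => - (h v)%:~R) (@frac R V) 1 1).
- by rewrite -mulr2n pnatr_eq0.
- move=> v w g e; have [_ gE] := hE _ _ _ e.
  have -> : - (h v)%:~R - - (h w)%:~R - 1 * g%:~R = 0 :> R.
    by rewrite gE rmorphB /=; ring.
  rewrite eqxx mul1r subr_eq0; apply/eqP => /frac_eq[vw g0].
  by apply: (@edges_loop _ G v); rewrite {2}vw -g0.
- by exists v0, v0, 1; rewrite !subrr !sub0r mul1r oppr_eq0 oner_eq0.
Qed.

Variable d : colouring G.

Hypothesis noalmost : forall k c, almost d k c -> walk_gain c <> 0.

Lemma flexible_lattice_flexible :
  (forall k, balanced (colour_subgraph d k)) ->
  exists x : placement R V, [/\ placement_lattice G x, full x & flexible G x].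
Proof.
move=> bal; have [[v0] _] := hG.
have [r [h [hE hW]]] := balanced_potential (bal Red).
have [r' [h' [hE' hW']]] := balanced_potential (bal Blue).
pose pos (r : V -> V) (h : V -> int) v := frac R (r v) - (h v)%:~R.
have pos0 k rk hk :
    (forall v w g, edges (colour_subgraph d k) (v, w, g) ->
      rk v = rk w /\ g = hk w - hk v) ->
    forall v w g, edges (colour_subgraph d k) (v, w, g) ->
      pos rk hk v - pos rk hk w - 1 * g%:~R = 0.
  by move=> E v w g /E[rvw ->]; rewrite /pos rvw rmorphB /=; ring.
(* A zero puts both ends in one component of colour [k]; the walk of that colour joining them closes
   the edge to a balanced almost monochromatic circuit. *)
have posn0 k rk hk :
    (forall v w, rk v = rk w ->
      exists2 c, walk (colour_subgraph d k) v c w & walk_gain c = hk w - hk v) ->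
    forall v w g, edges (colour_subgraph d (opp_col k)) (v, w, g) ->
      pos rk hk v - pos rk hk w - 1 * g%:~R != 0.
  move=> W v w g [Ge ek]; apply/eqP => e0.
  have /frac_eq[rvw /eqP] : frac R (rk v) - frac R (rk w) = (g + hk v - hk w)%:~R.
    by move: e0; rewrite /pos rmorphB rmorphD /= => /subr0_eq; lra.
  rewrite subr_eq0 => /eqP gE; have [c wc cE] := W _ _ (esym rvw).
  apply: (noalmost (almost_cons Ge ek wc)).
  by rewrite walk_gain_cons cE /egain /=; lia.
apply: (@flexible_of_directions _ _ _ (pos r h) (pos r' h') 1 1).
- by rewrite -mulr2n pnatr_eq0.
- move=> v w g e; case E: (col d (v, w, g)).
    by rewrite (pos0 Red) // eqxx (negPf (posn0 Blue _ _ hW' _ _ _ _)).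
  by rewrite (pos0 Blue r' h') // eqxx (negPf (posn0 Red _ _ hW _ _ _ _)).
- by exists v0, v0, 1; rewrite !subrr !sub0r mul1r oppr_eq0 oner_eq0.
Qed.

(** The second coordinate is constant on components of the other colour and has no lattice part, so
    the lattice stays fixed. An edge of colour [k] inside such a component would close to an
    excluded circuit. *)
Lemma fixed_lattice_flexible k :
  (exists2 e, edges G e & col d e = k) ->
  balanced (colour_subgraph d k) -> ~ (exists c, almost d (opp_col k) c) ->
  exists x : placement R V, [/\ placement_lattice G x, full x & flexible G x].
Proof.
move=> [[[v0 w0] g0] Ge0 ek0] bal noalm.
have [r [h [hE hW]]] := balanced_potential bal.
have [r' [r'_walk r'_conn _]] := component_representative (colour_subgraph d (opp_col k)).
have opp_colK : opp_col (opp_col k) = k by case: (k).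
have X0 v w g : edges G (v, w, g) -> col d (v, w, g) = k ->
    (frac R (r v) - (h v)%:~R) - (frac R (r w) - (h w)%:~R) - 1 * g%:~R = 0.
  by move=> Ge ek; have [| -> ->] := hE v w g; [by split | rewrite rmorphB /=; ring].
have Yn0 v w g : edges G (v, w, g) -> col d (v, w, g) = k ->
    frac R (r' v) - frac R (r' w) != 0.
  move=> Ge ek; apply/eqP => /(@frac_eq _ _ _ _ 0)[rvw _].
  have [c wc] := r'_conn _ _ (esym rvw).
  by apply: noalm; exists ((v, w, g) :: c); apply: almost_cons wc; rewrite ?opp_colK.
apply: (@flexible_of_directions _ _ _ (fun v => frac R (r v) - (h v)%:~R)
  (fun v => frac R (r' v)) 1 0).
- by rewrite addr0 oner_eq0.
- move=> v w g Ge; rewrite mul0r subr0.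
  have [ek|] := eqVneq (is_col k (col d (v, w, g))) true.
    have {}ek : col d (v, w, g) = k by apply/is_colP; rewrite ek.
    by rewrite X0 // eqxx (negPf (Yn0 _ _ _ Ge ek)).
  rewrite eqb_id -is_col_opp => /is_colP ek.
  have -> : r' v = r' w by apply: (r'_walk _ _ [:: (v, w, g)]).
  rewrite subrr eqxx addbT; apply/eqP => e0.
  have /frac_eq[rvw /eqP] : frac R (r v) - frac R (r w) = (g + h v - h w)%:~R.
    by move: e0; rewrite rmorphB rmorphD /= => /subr0_eq; lra.
  rewrite subr_eq0 => /eqP gE; have [c wc cE] := hW _ _ (esym rvw).
  apply: (noalmost (almost_cons Ge ek wc)).
  by rewrite walk_gain_cons cE /egain /=; lia.
(* Raising the gain of an edge of colour [k] by 1 changes X from 0 to -1 and leaves Y nonzero, since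
   b = 0. *)
- exists v0, w0, (g0 + 1); split; last by rewrite mul0r subr0; apply: Yn0 Ge0 ek0.
  apply/eqP => e1; have := X0 _ _ _ Ge0 ek0; move: e1; rewrite rmorphD /=; lra.
Qed.

End Converse.

(** * From a valuation ring to a colouring *)

Section MaximalIdeal.
Variables (F : fieldType) (O : set F).
Hypotheses (hO : subring O) (Oval : forall x, O x \/ O x^-1).

(** The maximal ideal of [O]; 0 is listed apart because its inverse is 0 by convention, which lies
    in [O]. *)
Definition nonunit : set F := [set x | x = 0 \/ ~ O x^-1].

Lemma nonunit_sub : nonunit `<=` O.
Proof. by move=> x [->|nx]; [exact: subring0 | case: (Oval x)]. Qed.

Lemma nonunitM a x : O a -> nonunit x -> nonunit (a * x).
Proof.
move=> Oa [->|nx]; first by left; rewrite mulr0.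
have [->|a0] := eqVneq a 0; first by left; rewrite mul0r.
right=> Oax; apply: nx.
by have -> : x^-1 = a * (a * x)^-1; [rewrite invfM mulVKf | exact: subringM].
Qed.

Lemma nonunitB x y : nonunit x -> nonunit y -> nonunit (x - y).
Proof.
have [->|x0] := eqVneq x 0.
  by move=> _ my; rewrite sub0r -mulN1r; apply: nonunitM => //; apply: subring_int hO (-1).
have [->|y0] := eqVneq y 0; first by rewrite subr0.
move=> mx my; case: (Oval (x / y)) => h.
  have -> : x - y = (x / y - 1) * y by rewrite mulrBl divfK // mul1r.
  by apply: nonunitM => //; apply: subringB => //; apply: subring1.
have -> : x - y = (1 - (x / y)^-1) * x by rewrite invf_div mulrBl divfK // mul1r.
by apply: nonunitM => //; apply: subringB => //; apply: subring1.
Qed.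

End MaximalIdeal.

Section EdgeVectors.
Variables (F : numFieldType) (V : finType).

Definition edge_vec (a : V -> F) (l : F) (e : oedge V) : F :=
  a (esrc e) - a (etgt e) - l * (egain e)%:~R.

Lemma edge_vec_rev a l e : edge_vec a l (erev e) = - edge_vec a l e.
Proof.
by rewrite /edge_vec /esrc /etgt /egain /= rmorphN /=; ring.
Qed.

Lemma edge_vec_scale a l c e :
  edge_vec (fun v => a v * c) (l * c) e = edge_vec a l e * c.
Proof. by rewrite /edge_vec; ring. Qed.

(** [S] stands for the valuation ring (blue) or its maximal ideal (red), so that one argument serves
    both colours. *)
Variables (G : gain_graph V) (S : set F) (a : V -> F) (l : F).
Hypotheses (S0 : S 0) (SB : forall x y, S x -> S y -> S (x - y)).
Hypothesis Sdiv : forall (n : int) x, n != 0 -> S (x * n%:~R) -> S x.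

Let SD x y : S x -> S y -> S (x + y).
Proof. by move=> Sx Sy; rewrite -[y]opprK -[- y]sub0r; do !apply: SB. Qed.

Let SMz x (n : int) : S x -> S (x * n%:~R).
Proof.
move=> Sx; rewrite mulrzr.
have Sn m : S (x *+ m) by elim: m => [//|m IH]; rewrite mulrS; apply: SD.
by case: n => n; [exact: Sn | rewrite NegzE mulrNz -sub0r; apply: SB => //; apply: (Sn n.+1)].
Qed.

Lemma sum_edge_vec v w c : walk G v c w ->
  \sum_(e <- c) edge_vec a l e = a v - a w - l * (walk_gain c)%:~R.
Proof.
elim: c v => [|e c IH] v /=.
  by move=> ->; rewrite /walk_gain !big_nil mulr0 subrr subr0.
case=> Ge <- /IH h; rewrite big_cons h walk_gain_cons rmorphD /= /edge_vec.
by ring.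
Qed.

Lemma sum_edge_vec_in c : (forall e, e \in c -> S (edge_vec a l e)) ->
  S (\sum_(e <- c) edge_vec a l e).
Proof.
by move=> h; rewrite big_seq; apply: (big_ind S).
Qed.

(** Around a circuit the vertex terms cancel, leaving [l] times minus the gain, and [S] allows
    division by nonzero integers. *)
Lemma lattice_in (c : seq (oedge V)) : circuit G c ->
  (forall e, e \in c -> S (edge_vec a l e)) -> walk_gain c <> 0 -> S l.
Proof.
move=> [_ [v vc]] /sum_edge_vec_in; rewrite (sum_edge_vec vc) subrr => h /eqP c0.
apply: (Sdiv c0); rewrite -[_ * _]opprK -sub0r -[- (_ * _)]sub0r.
exact: SB.
Qed.

Lemma difference_in : graph_connected G -> ~ balanced G ->
  (forall e, edges G e -> S (edge_vec a l e)) ->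
  forall v w (g : int), S (a v - a w - l * g%:~R).
Proof.
move=> [_ conn] /existsNP[c0 /not_implyP[circ0 gain0]] all_in v w g.
have Sl : S l.
  apply: (lattice_in circ0) => // e ec; apply: all_in.
  by have [_ [u uc]] := circ0; apply: walk_edges uc _ ec.
have [c vw] := conn v w.
have -> : a v - a w - l * g%:~R =
    (a v - a w - l * (walk_gain c)%:~R) + l * (walk_gain c - g)%:~R.
  by rewrite rmorphB /=; ring.
rewrite -(sum_edge_vec vw); apply: SD (SMz _ Sl).
by apply: sum_edge_vec_in => e ec; apply/all_in/(walk_edges vw).
Qed.

Variables (d : colouring G) (k : colour).
Hypothesis colE : forall e, edges G e -> col d e = k <-> S (edge_vec a l e).

(** All terms but one lie in [S]. *)
Lemma almost_not_in c : almost d k c -> ~ S (\sum_(e <- c) edge_vec a l e).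
Proof.
move=> [[_ [v vc]]]; move: v {1}v vc.
elim: c => // e c IH v w /= [Ge _ wc]; rewrite is_col_opp big_cons.
case: (is_colP k (col d e)) => [ek|nek] /=.
  rewrite add0n => /(IH _ _ wc) nS Sec; apply: nS.
  by rewrite -[X in S X](addKr (edge_vec a l e)) addrC; apply: SB => //; apply/colE.
rewrite add1n => -[/eqP]; rewrite -leqn0 leqNgt -has_count -all_predC => /allP ck Sec.
apply: nek; apply/colE => //.
rewrite -[X in S X](addrK (\sum_(j <- c) edge_vec a l j)); apply: SB => //.
apply: sum_edge_vec_in => f fc; apply/colE; first exact: walk_edges wc _ fc.
by apply/is_colP; move: (ck _ fc); rewrite /= is_col_opp negbK.
Qed.

Lemma almost_unbalanced c : almost d k c -> walk_gain c <> 0.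
Proof.
move=> alm c0; apply: (almost_not_in alm); have [[_ [v vc]] _] := alm.
by rewrite (sum_edge_vec vc) c0 mulr0 subrr subr0.
Qed.

(** Once [l] is in [S], so is the sum around every circuit, against [almost_not_in]. *)
Lemma unbalanced_colour : ~ balanced (colour_subgraph d k) ->
  S l /\ ~ exists c, almost d k c.
Proof.
move=> /existsNP[c0 /not_implyP[circ0 gain0]].
have [_ [u uc]] := circ0; have [uGc _] := colour_walk uc.
have Sl : S l.
  apply: (@lattice_in c0) => //; first by split; [case: circ0 | exists u].
  by move=> e /(walk_edges uc)[Ge ek]; apply/colE.
split=> // -[c alm]; apply: (almost_not_in alm); have [[_ [v vc]] _] := alm.
by rewrite (sum_edge_vec vc) subrr; apply: SB => //; apply: SMz.
Qed.

End EdgeVectors.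

Lemma valuation_colouring (F : numFieldType) (V : finType) (G : gain_graph V)
    (O : set F) (w z : V -> F) (lw lz : F) :
    subring O -> (forall x, O x \/ O x^-1) ->
    (forall n : int, O n%:~R^-1) ->
    (forall e, edges G e -> let q := edge_vec w lw e * edge_vec z lz e in
       [/\ q != 0, O q & O q^-1]) ->
    ~ nonunit O (lw * lz) ->
    (exists v u (g : int), ~ O ((w v - w u - lw * g%:~R) * (z v - z u - lz * g%:~R))) ->
    graph_connected G -> ~ balanced G ->
  exists d : colouring G, fixed_lattice_NBAC d \/ flexible_1_lattice_NBAC d.
Proof.
move=> hO Oval Oint edgeU latU [v1 [u1 [g1 nO1]]] hG unbal.
pose W := edge_vec w lw; pose Z := edge_vec z lz.
have W0 e : edges G e -> W e != 0.
  by case/edgeU; rewrite mulf_eq0 negb_or => /andP[].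
have Odiv (n : int) x : n != 0 -> O (x * n%:~R) -> O x.
  move=> n0 h; have n0' : n%:~R != 0 :> F by rewrite intr_eq0.
  by rewrite -[x](mulfK n0'); apply: subringM.
have mdiv (n : int) x : n != 0 -> nonunit O (x * n%:~R) -> nonunit O x.
  move=> n0 h; have n0' : n%:~R != 0 :> F by rewrite intr_eq0.
  by rewrite -[x](mulfK n0') mulrC; apply: nonunitM.
have m0 : nonunit O 0 by left.
have OB := subringB hO; have mB := nonunitB hO Oval.
have O0 := subring0 hO.
(* Scaling the two coordinates inversely keeps their products and normalises them by the reference
   edge. *)
pose w' c v := w v / c; pose z' c v := z v * c.
have wE c e : edge_vec (w' c) (lw / c) e = W e / c by exact: edge_vec_scale.
have zE c e : edge_vec (z' c) (lz * c) e = Z e * c by exact: edge_vec_scale.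
(* If all quotients W e / W e' were in [O], both normalised coordinates of every difference would be
   in [O] by [difference_in], and so would their product, against [nO1]. The edges found make the
   colouring surjective: [e0] is blue and [e1] red. *)
have [e0 [e1 [Ge0 Ge1 nO]]] : exists e0 e1, [/\ edges G e0, edges G e1 & ~ O (W e1 / W e0)].
  apply: contrapT => all_eq.
  have {}all_eq e e' : edges G e -> edges G e' -> O (W e / W e').
    by move=> Ge Ge'; apply: contrapT => nO; apply: all_eq; exists e', e.
  have [e0 Ge0] : exists e, edges G e.
    have /existsNP[[|e c] /not_implyP[[c0 [v vc]] _]] := unbal; first by [].
    by case: vc => Ge _ _; exists e.
  apply: nO1.
  have -> : (w v1 - w u1 - lw * g1%:~R) * (z v1 - z u1 - lz * g1%:~R) =
    (w' (W e0) v1 - w' (W e0) u1 - lw / W e0 * g1%:~R) *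
    (z' (W e0) v1 - z' (W e0) u1 - lz * W e0 * g1%:~R).
    by rewrite /w' /z'; have := W0 _ Ge0; move: (W e0) => c c0; field.
  apply: subringM => //; apply: (difference_in O0 OB Odiv hG unbal) => e Ge.
    by rewrite wE; apply: all_eq.
  rewrite zE; have [_ Oq _] := edgeU _ Ge.
  have -> : Z e * W e0 = (W e * Z e) * (W e0 / W e).
    by have := W0 _ Ge; move: (W e) => c c0; field.
  by apply: subringM => //; apply: all_eq.
pose c e := if `[< O (W e / W e0) >] then Blue else Red.
have c_rev e : edges G e -> c (erev e) = c e.
  move=> _; rewrite /c /W edge_vec_rev mulNr; congr (if _ then _ else _).
  by apply: asbool_equiv_eq; split=> /(subringN hO) //; rewrite opprK.
pose d := Colouring c_rev.
have blueE e : edges G e -> col d e = Blue <-> O (edge_vec (w' (W e0)) (lw / W e0) e).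
  by move=> _; rewrite wE /= /c; case: asboolP; split.
have redE e : edges G e -> col d e = Red <-> nonunit O (edge_vec (z' (W e0)) (lz * W e0) e).
  move=> Ge; have [q0 Oq Oq'] := edgeU _ Ge.
  have We := W0 _ Ge; have We0 := W0 _ Ge0.
  have Ze : Z e != 0 by move: q0; rewrite mulf_eq0 negb_or => /andP[].
  have wz : W e / W e0 = (W e * Z e) * (Z e * W e0)^-1.
    by field; rewrite We0 Ze.
  have zw : (Z e * W e0)^-1 = (W e / W e0) * (W e * Z e)^-1.
    by field; rewrite We Ze We0.
  rewrite zE /= /c; split=> [h|h].
    right=> h'; move: h; case: asboolP => // -[]; rewrite wz; exact: subringM.
  case: asboolP => // Oe; case: h => [/eqP|[]].
    by rewrite mulf_eq0 (negPf Ze) (negPf We0).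
  by rewrite zw; apply: subringM.
have almost_blue := almost_unbalanced O0 OB blueE.
have almost_red := almost_unbalanced m0 mB redE.
have nbac : NBAC d.
  split.
  - case; last by exists e0 => //; apply/blueE; rewrite ?wE ?divff ?W0 //; apply: subring1.
    by exists e1 => //=; rewrite /c; case: asboolP.
  - by case=> C [/almost_red].
  - by case=> C [/almost_blue].
exists d.
have [balR|unbalR] := pselect (balanced (colour_subgraph d Red)); last first.
  have [mlz no_almost] := unbalanced_colour m0 mB mdiv redE unbalR.
  have [balB|unbalB] := pselect (balanced (colour_subgraph d Blue)); last first.
    have [Olw _] := unbalanced_colour O0 OB Odiv blueE unbalB.
    exfalso; apply: latU.
    have -> : lw * lz = (lw / W e0) * (lz * W e0).
      by have := W0 _ Ge0; move: (W e0) => q q0; field.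
    exact: nonunitM.
  by left; split=> //; right.
have [balB|unbalB] := pselect (balanced (colour_subgraph d Blue)); first by right; split.
have [_ no_almost] := unbalanced_colour O0 OB Odiv blueE unbalB.
by left; split=> //; left.
Qed.

(** * From a flex to a valuation ring *)

(* The ring is [A[c^-1]] with [A] generated by [g]; it contains [c] only if [c] *)
(* is integral over [A], which gives a countable set of exceptions.             *)
Lemma countable_nonintegral (F : closedFieldType) (I : countType) (g : I -> F) :
  exists C : set F, countable C /\
    forall c, ~ C c -> exists A, [/\ subring A, forall i, A (g i), A c^-1 & ~ A c].
Proof.
pose gX (i : option I) : {poly F} := if i is Some j then (g j)%:P else 'X.
have [B [cB [B1 BB BM] Bg]] := countable_subring gX.
(* c = p(c^-1) makes c^-1 a root of X p - 1, which is nonzero since its value at 0 is -1; so each p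
   has finitely many bad c. *)
pose bad (p : {poly F}) : set F := [set c | c = 0 \/ root ('X * p - 1) c^-1].
exists (\bigcup_(p in B) bad p); split.
  apply: bigcup_countable => // p _.
  have q0 : 'X * p - 1 != 0.
    apply/eqP => /(congr1 (fun q => q.[0])).
    by rewrite !hornerE => /eqP; rewrite oppr_eq0 oner_eq0.
  have [rs rsE] := closed_field_poly_normal ('X * p - 1).
  apply: (@sub_countable _ _ _ [set` 0 :: map GRing.inv rs]); last first.
    by apply: finite_set_countable; exact: finite_seq.
  apply: subset_card_le => c /= [->|]; first by rewrite inE eqxx.
  rewrite rsE rootZ ?lead_coef_eq0 // root_prod_XsubC => h.
  by rewrite inE -[c]invrK map_f ?orbT.
move=> c nC.
have c0 : c != 0 by apply: contra_notN nC => /eqP ->; exists 1 => //; left.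
exists [set p.[c^-1] | p in B]; split.
- split; first by exists 1; rewrite ?hornerC.
  + by move=> _ _ [p Bp <-] [q Bq <-]; exists (p - q); rewrite ?hornerD ?hornerN //; apply: BB.
  + by move=> _ _ [p Bp <-] [q Bq <-]; exists (p * q); rewrite ?hornerM //; apply: BM.
- by move=> i; exists (g i)%:P; rewrite ?hornerC //; apply: (Bg (Some i)).
- by exists 'X; rewrite ?hornerX //; apply: (Bg None).
- move=> [p Bp pc]; apply: nC; exists p => //; right.
  by rewrite /root !hornerE pc mulVf // subrr.
Qed.

(** A countable set has Lebesgue measure 0, the interval b - a > 0. *)
Lemma itv_not_countable (R : realType) (a b : R) (D : set R) :
  a < b -> countable D -> exists2 r, a < r < b & ~ D r.
Proof.
move=> ab cD; apply: contrapT => h.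
have sub : `]a, b[%classic `<=` D.
  move=> r /=; rewrite in_itv /= => rab; apply: contrapT => nD.
  by apply: h; exists r.
have := countable_lebesgue_measure0 (sub_countable (subset_card_le sub) cD).
by rewrite lebesgue_measure_itv /= lte_fin ab -EFinD => -[] /eqP; rewrite subr_eq0 gt_eqF.
Qed.

Section ComplexCoordinates.
Variables (R : realType) (V : finType).

Local Open Scope complex_scope.

Definition cplx (u : 'M[R]_(2, 1)) : R[i] := u 0 0 +i* u 1 0.
Definition cplxc (u : 'M[R]_(2, 1)) : R[i] := u 0 0 -i* u 1 0.

Lemma cplx_sqlen (x : placement R V) v w g :
  (cplx (x.1 v) - cplx (x.1 w) - cplx x.2 * g%:~R) *
  (cplxc (x.1 v) - cplxc (x.1 w) - cplxc x.2 * g%:~R) = (sqlen x v w g)%:C.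
Proof.
have -> : g%:~R = (g%:~R : R)%:C :> R[i] by rewrite rmorph_int.
rewrite sqlenE /cplx /cplxc; simpc.
by congr (_ +i* _); ring.
Qed.

Lemma sqlen_lattice (x : placement R V) v :
  (sqlen x v v 1)%:C = cplx x.2 * cplxc x.2.
Proof. by rewrite -cplx_sqlen !subrr !sub0r !mulr1 mulrNN. Qed.

Lemma sqnorm_eq0 (u : 'cV[R]_2) : sqnorm u = 0 -> u = 0.
Proof.
move=> /eqP; rewrite psumr_eq0 => [/allP h|i _]; last exact: sqr_ge0.
apply/matrixP => i j; rewrite ord1 mxE; apply/eqP.
by rewrite -sqrf_eq0; apply: (implyP (h i _)) => //; rewrite mem_index_enum.
Qed.

Lemma continuous_sqlen (D : set R) (z : R -> placement R V) v w g :
  (forall v, {within D, continuous (fun t => (z t).1 v)}) ->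
  {within D, continuous (fun t => (z t).2)} ->
  {within D, continuous (fun t => sqlen (z t) v w g)}.
Proof.
move=> zp zL.
have entry (f : R -> 'M[R]_(2, 1)) i : {within D, continuous f} ->
    {within D, continuous (fun t => f t i 0)}.
  move=> cf t; apply: (cvg_comp f (fun M : 'M[R]_(2, 1) => M i 0) (cf t)).
  exact: coord_continuous.
have lin i : {within D,
    continuous (fun t => (z t).1 v i 0 - (z t).1 w i 0 - (z t).2 i 0 * g%:~R)}.
  move=> t; apply: cvgB; last by apply: cvgM; [exact: (entry _ i zL) | exact: cvg_cst].
  by apply: cvgB; [exact: (entry _ i (zp v)) | exact: (entry _ i (zp w))].
rewrite (_ : (fun t => _) = fun t =>
  ((z t).1 v 0 0 - (z t).1 w 0 0 - (z t).2 0 0 * g%:~R) *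
  ((z t).1 v 0 0 - (z t).1 w 0 0 - (z t).2 0 0 * g%:~R) +
  ((z t).1 v 1 0 - (z t).1 w 1 0 - (z t).2 1 0 * g%:~R) *
  ((z t).1 v 1 0 - (z t).1 w 1 0 - (z t).2 1 0 * g%:~R)); last first.
  by apply/funext => t; rewrite sqlenE.
by move=> t; apply: cvgD; apply: cvgM; exact: lin.
Qed.

End ComplexCoordinates.

Lemma flexible_colouring (R : realType) (V : finType) (G : gain_graph V)
    (x : placement R V) :
  graph_connected G -> ~ balanced G ->
  placement_lattice G x -> full x -> flexible G x ->
  exists d : colouring G, fixed_lattice_NBAC d \/ flexible_1_lattice_NBAC d.
Proof.
move=> hG unbal px fullx [z [[zp zL z0 _ zeq] nontriv]].
have [[v0] _] := hG.
have [v [w [g [t1 [t101 ne lat_cst]]]]] : exists v w (g : int) t1,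
    [/\ 0 <= t1 <= 1, sqlen (z t1) v w g <> sqlen x v w g &
    (v = w /\ g = 1) \/ forall t, 0 <= t <= 1 -> sqlen (z t) v0 v0 1 = sqlen x v0 v0 1].
  have [cst|ncst] := pselect (forall t, 0 <= t <= 1 -> sqlen (z t) v0 v0 1 = sqlen x v0 v0 1).
    move: nontriv => /existsNP[t1 /not_implyP[t101 /existsNP[v /existsNP[w /existsNP[g ne]]]]].
    by exists v, w, g, t1; split=> //; right.
  move: ncst => /existsNP[t1 /not_implyP[t101 ne]].
  by exists v0, v0, 1, t1; split=> //; left.
(* All triples occur, not only edges, because the squared norm of the lattice vector,
   [sqlen x v0 v0 1], must be covered as well. *)
pose gen (i : bool * (V * V * int) + int) : R[i] := match i with
  | inl (b, (v, w, g)) => let s := (sqlen x v w g)%:C%C in if b then s else s^-1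
  | inr n => n%:~R^-1
  end.
have [C [cC hC]] := countable_nonintegral gen.
pose f t := sqlen (z t) v w g.
(* The length takes different values at times 0 and [t1]; any non-exceptional value strictly between
   is attained at some time by the intermediate value theorem. *)
have [r /andP[ar rb] nCr] : exists2 r,
    Num.min (f 0) (f t1) < r < Num.max (f 0) (f t1) & ~ C r%:C%C.
  apply: (@itv_not_countable _ _ _ [set r | C r%:C%C]).
    by have [//|//|e] := ltgtP (f 0) (f t1); case: ne; rewrite -/(f t1) -e /f z0.
  apply: (sub_countable _ cC); apply: card_le_trans (card_image_le (@complex.Re R) C).
  by apply: subset_card_le => s Cs; exists s%:C%C.
have /andP[t10 t1le] := t101.
have [t tin ft] : exists2 t, t \in `[0, t1] & f t = r.
  apply: IVT => //; last by rewrite !ltW.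
  apply: continuous_subspaceW (continuous_sqlen zp zL).
  by move=> s /=; rewrite !in_itv /= => /andP[-> /le_trans]; apply.
have t01 : 0 <= t <= 1.
  by move: tin; rewrite in_itv /= => /andP[-> /le_trans]; apply.
have [A [hA Agen Ac nAc]] := hC _ nCr.
have [B [hB AB nBc Bval]] := valuation_ring_exists hA Ac nAc.
have Bs u1 u2 k : B (sqlen x u1 u2 k)%:C%C by apply/AB/(Agen (inl (true, (u1, u2, k)))).
have Bs' u1 u2 k : B (sqlen x u1 u2 k)%:C%C^-1 by apply/AB/(Agen (inl (false, (u1, u2, k)))).
apply: (@valuation_colouring _ _ _ B (fun v => cplx ((z t).1 v)) (fun v => cplxc ((z t).1 v))
  (cplx (z t).2) (cplxc (z t).2)) => //.
- by move=> n; apply/AB/(Agen (inr n)).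
- move=> [[u u'] k] Ge; rewrite /edge_vec /= cplx_sqlen zeq //; split=> //.
  rewrite fmorph_eq0; apply/eqP => /sqnorm_eq0 /eqP.
  rewrite -addrA -opprD subr_eq0 => /eqP; exact: px Ge.
(* Either the squared norm of the lattice vector is the chosen length, outside [B], or it is
   constant along the flex; its inverse is then a generator, and fullness makes it nonzero. *)
- rewrite -(sqlen_lattice _ v0); case: lat_cst => [[vw g1]|cst].
    move=> /(nonunit_sub hB Bval); apply: contra_not nBc.
    by rewrite -ft /f vw g1 !sqlen_lattice.
  rewrite cst // => -[/eqP|/(_ (Bs' _ _ _))//].
  rewrite fmorph_eq0 => /eqP /sqnorm_eq0.
  rewrite subrr sub0r => /eqP; rewrite oppr_eq0 => /eqP L0.
  have /matrixP /(_ 0 0) : (1%:~R)%:M = 0 :> 'cV[R]_1.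
    by apply: fullx; rewrite /= mulmx0; exact: L0.
  by rewrite !mxE => /eqP; rewrite oner_eq0.
- by exists v, w, g; rewrite cplx_sqlen; move: nBc; rewrite -ft.
Qed.

Theorem theorem5p1 (R : realType) (V : finType) (G : gain_graph V)
    (hG : graph_connected G) :
  (exists x : placement R V,
     [/\ placement_lattice G x, full x & flexible G x]) <->
  [\/ exists d : colouring G, fixed_lattice_NBAC d,
      exists d : colouring G, flexible_1_lattice_NBAC d |
      balanced G].
Proof.
split=> [[x [px fullx flx]]|].
  have [bal|unbal] := pselect (balanced G); first by apply: Or33.
  have [d [fix_d|flex_d]] := flexible_colouring hG unbal px fullx flx.
    by apply: Or31; exists d.
  by apply: Or32; exists d.
have noalmost d : NBAC d -> forall k c, @almost V G d k c -> walk_gain c <> 0.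
  by case=> _ nr nb [] c alm c0; [apply: nr | apply: nb]; exists c.
case=> [[d [nbac [[bal na]|[bal na]]]]|[d [nbac balR balB]]|].
- by have [surj _ _] := nbac; apply: (fixed_lattice_flexible _ (noalmost _ nbac) (surj Red) bal).
- by have [surj _ _] := nbac; apply: (fixed_lattice_flexible _ (noalmost _ nbac) (surj Blue) bal).
- by apply: (flexible_lattice_flexible _ hG (noalmost _ nbac)); case.
- exact: balanced_flexible.
Qed.
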